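(* Let $(\mathscr{K},\otimes,1)$ be a tensor triangulated category. If the space $\operatorname{Spc}(\mathscr{K})$ is not empty, it admits a closed point. More precisely, any non-empty closed subset of $\operatorname{Spc}(\mathscr{K})$ contains at least one closed point.
   Context: All categories are essentially small. A tensor triangulated category $(\mathscr{K},\otimes,1)$ is a triangulated category $\mathscr{K}$ (translation functor $T$) with a symmetric monoidal product $\otimes:\mathscr{K}\times\mathscr{K}\to\mathscr{K}$ which is exact in each variable, with unit $1$. A thick $\otimes$-ideal of $\mathscr{K}$ is a full subcategory $\mathscr{A}$ containing $0$ such that: (a) for any distinguished triangle $a\to b\to c\to Ta$, if two of $a,b,c$ belong to $\mathscr{A}$ then so does the third; (b) if $a\in\mathscr{A}$ and $a\simeq b\oplus c$ in $\mathscr{K}$ then $b,c\in\mathscr{A}$; (c) if $a\in\mathscr{A}$ and $b\in\mathscr{K}$ then $a\otimes b\in\mathscr{A}$. A prime of $\mathscr{K}$ is a thick $\otimes$-ideal $\mathscr{P}\subsetneq\mathscr{K}$ such that $a\otimes b\in\mathscr{P}$ implies $a\in\mathscr{P}$ or $b\in\mathscr{P}$. $\operatorname{Spc}(\mathscr{K})$ is the set of all primes of $\mathscr{K}$, with the Zariski topology, whose closed subsets are the sets $Z(\mathscr{S})=\{\mathscr{P}\in\operatorname{Spc}(\mathscr{K})\mid\mathscr{S}\cap\mathscr{P}=\varnothing\}$ for collections of objects $\mathscr{S}\subset\mathscr{K}$. *)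

(* Defs.v *)
From HB Require Import structures.
From mathcomp Require Import all_boot all_order all_algebra.
From mathcomp Require Import boolp classical_sets topology.

Set Implicit Arguments.
Unset Strict Implicit.
Unset Printing Implicit Defensive.

Import GRing.Theory.
Local Open Scope classical_set_scope.
Local Open Scope ring_scope.

Declare Scope tt_scope.
Delimit Scope tt_scope with tt.
Local Open Scope tt_scope.

Reserved Notation "g ∘ f" (at level 40, left associativity).
Reserved Notation "a ⊗ b" (at level 40, left associativity).
Reserved Notation "a ⊕ b" (at level 50, left associativity).

Record preadditive := Preadditive {
  obj :> Type;
  hom : obj -> obj -> zmodType;
  idm : forall a, hom a a;
  comp : forall a b c, hom b c -> hom a b -> hom a c;
  compA : forall a b c d (h : hom c d) (g : hom b c) (f : hom a b),
    comp h (comp g f) = comp (comp h g) f;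
  comp1m : forall a b (f : hom a b), comp (idm b) f = f;
  compm1 : forall a b (f : hom a b), comp f (idm a) = f;
  compDl : forall a b c (g g' : hom b c) (f : hom a b),
    comp (g + g') f = comp g f + comp g' f;
  compDr : forall a b c (g : hom b c) (f f' : hom a b),
    comp g (f + f') = comp g f + comp g f' }.

Arguments hom {p} a b.
Arguments idm {p} a.
Arguments comp {p a b c} g f.
Notation "g ∘ f" := (comp g f) : tt_scope.

Section Isomorphisms.
Variable C : preadditive.

Definition is_iso (a b : C) (f : hom a b) : Prop :=
  exists g : hom b a, g ∘ f = idm a /\ f ∘ g = idm b.

Definition isomorphic (a b : C) : Prop := exists f : hom a b, is_iso f.

End Isomorphisms.

(* In a preadditive category initial and terminal objects are those whose
   outgoing, respectively incoming, hom-groups are trivial. *)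
Record additive := Additive {
  add_cat :> preadditive;
  zob : add_cat;
  zob_initial : forall a (f : hom zob a), f = 0;
  zob_terminal : forall a (f : hom a zob), f = 0;
  osum : add_cat -> add_cat -> add_cat;
  inj1 : forall a b, hom a (osum a b);
  inj2 : forall a b, hom b (osum a b);
  prj1 : forall a b, hom (osum a b) a;
  prj2 : forall a b, hom (osum a b) b;
  prj1_inj1 : forall a b, prj1 a b ∘ inj1 a b = idm a;
  prj2_inj2 : forall a b, prj2 a b ∘ inj2 a b = idm b;
  prj1_inj2 : forall a b, prj1 a b ∘ inj2 a b = 0;
  prj2_inj1 : forall a b, prj2 a b ∘ inj1 a b = 0;
  osum_id : forall a b,
    inj1 a b ∘ prj1 a b + inj2 a b ∘ prj2 a b = idm (osum a b) }.

Arguments zob {_}.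
Arguments osum {_} _ _.
Notation "a ⊕ b" := (osum a b) : tt_scope.

Record functor (C D : preadditive) := Functor {
  fob :> C -> D;
  fmap : forall a b, hom a b -> hom (fob a) (fob b);
  fmap1 : forall a, fmap (idm a) = idm (fob a);
  fmapM : forall a b c (g : hom b c) (f : hom a b),
    fmap (g ∘ f) = fmap g ∘ fmap f }.

Arguments fmap {C D} _ {a b} _.

Definition functor_id (C : preadditive) : functor C C :=
  @Functor C C id (fun a b f => f) (fun a => erefl) (fun a b c g f => erefl).

Section FunctorComp.
Variables (C D E : preadditive) (G : functor D E) (F : functor C D).

Lemma functor_comp1 (a : C) : fmap G (fmap F (idm a)) = idm (G (F a)).
Proof. by rewrite !fmap1. Qed.

Lemma functor_compM (a b c : C) (g : hom b c) (f : hom a b) :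
  fmap G (fmap F (g ∘ f)) = fmap G (fmap F g) ∘ fmap G (fmap F f).
Proof. by rewrite !fmapM. Qed.

Definition functor_comp : functor C E :=
  @Functor C E (fun a => G (F a)) (fun a b f => fmap G (fmap F f))
    functor_comp1 functor_compM.

End FunctorComp.

Definition additive_functor (C D : preadditive) (F : functor C D) : Prop :=
  forall (a b : C) (f g : hom a b), fmap F (f + g) = fmap F f + fmap F g.

Definition natural_iso (C D : preadditive) (F G : functor C D)
    (eta : forall a : C, hom (F a) (G a)) : Prop :=
  (forall (a b : C) (f : hom a b), eta b ∘ fmap F f = fmap G f ∘ eta a) /\
  (forall a, is_iso (eta a)).

Definition naturally_isomorphic (C D : preadditive) (F G : functor C D) : Prop :=
  exists eta : forall a : C, hom (F a) (G a), natural_iso eta.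

Definition equivalence (C D : preadditive) (F : functor C D) : Prop :=
  exists G : functor D C,
    naturally_isomorphic (functor_comp G F) (functor_id C) /\
    naturally_isomorphic (functor_comp F G) (functor_id D).

Record triangulated := Triangulated {
  tri_cat :> additive;
  T : functor tri_cat tri_cat;
  T_additive : additive_functor T;
  T_equivalence : equivalence T;
  dist : forall a b c : tri_cat, hom a b -> hom b c -> hom c (T a) -> Prop;
  dist_iso : forall (a b c a' b' c' : tri_cat)
      (f : hom a b) (g : hom b c) (h : hom c (T a))
      (f' : hom a' b') (g' : hom b' c') (h' : hom c' (T a'))
      (u : hom a a') (v : hom b b') (w : hom c c'),
    is_iso u -> is_iso v -> is_iso w ->
    v ∘ f = f' ∘ u -> w ∘ g = g' ∘ v -> fmap T u ∘ h = h' ∘ w ->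
    dist f g h -> dist f' g' h';
  dist_id : forall a : tri_cat,
    dist (idm a) (0 : hom a zob) (0 : hom zob (T a));
  dist_cone : forall (a b : tri_cat) (f : hom a b),
    exists (c : tri_cat) (g : hom b c) (h : hom c (T a)), dist f g h;
  dist_rot : forall (a b c : tri_cat)
      (f : hom a b) (g : hom b c) (h : hom c (T a)),
    dist f g h <-> dist g h (- fmap T f);
  dist_morphism : forall (a b c a' b' c' : tri_cat)
      (f : hom a b) (g : hom b c) (h : hom c (T a))
      (f' : hom a' b') (g' : hom b' c') (h' : hom c' (T a'))
      (u : hom a a') (v : hom b b'),
    dist f g h -> dist f' g' h' -> v ∘ f = f' ∘ u ->
    exists w : hom c c', w ∘ g = g' ∘ v /\ fmap T u ∘ h = h' ∘ w;
  dist_octahedron : forall (a b c z x y : tri_cat)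
      (f : hom a b) (f' : hom b z) (f'' : hom z (T a))
      (g : hom b c) (g' : hom c x) (g'' : hom x (T b))
      (k' : hom c y) (k'' : hom y (T a)),
    dist f f' f'' -> dist g g' g'' -> dist (g ∘ f) k' k'' ->
    exists (u : hom z y) (v : hom y x),
      [/\ dist u v (fmap T f' ∘ g''),
          u ∘ f' = k' ∘ g, k'' ∘ u = f'',
          v ∘ k' = g' & g'' ∘ v = fmap T f ∘ k''] }.

Arguments T {t}.
Arguments dist {t a b c} f g h.

Definition exact_functor (C D : triangulated) (F : functor C D) : Prop :=
  additive_functor F /\
  exists phi : forall a : C, hom (F (T a)) (T (F a)),
    @natural_iso C D (functor_comp F T) (functor_comp T F) phi /\
    forall (a b c : C) (f : hom a b) (g : hom b c) (h : hom c (T a)),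
      dist f g h -> dist (fmap F f) (fmap F g) (phi a ∘ fmap F h).

Record symmetric_monoidal (C : preadditive) := SymmetricMonoidal {
  tens : C -> C -> C;
  tensm : forall a a' b b' : C,
    hom a a' -> hom b b' -> hom (tens a b) (tens a' b');
  tensm1 : forall a b, tensm (idm a) (idm b) = idm (tens a b);
  tensmM : forall (a a' a'' b b' b'' : C)
      (f' : hom a' a'') (f : hom a a') (g' : hom b' b'') (g : hom b b'),
    tensm (f' ∘ f) (g' ∘ g) = tensm f' g' ∘ tensm f g;
  tunit : C;
  assoc : forall a b c, hom (tens (tens a b) c) (tens a (tens b c));
  lunit : forall a, hom (tens tunit a) a;
  runit : forall a, hom (tens a tunit) a;
  braid : forall a b, hom (tens a b) (tens b a);
  assoc_iso : forall a b c, is_iso (assoc a b c);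
  lunit_iso : forall a, is_iso (lunit a);
  runit_iso : forall a, is_iso (runit a);
  assoc_natural : forall (a a' b b' c c' : C)
      (f : hom a a') (g : hom b b') (h : hom c c'),
    assoc a' b' c' ∘ tensm (tensm f g) h =
    tensm f (tensm g h) ∘ assoc a b c;
  lunit_natural : forall (a a' : C) (f : hom a a'),
    lunit a' ∘ tensm (idm tunit) f = f ∘ lunit a;
  runit_natural : forall (a a' : C) (f : hom a a'),
    runit a' ∘ tensm f (idm tunit) = f ∘ runit a;
  braid_natural : forall (a a' b b' : C) (f : hom a a') (g : hom b b'),
    braid a' b' ∘ tensm f g = tensm g f ∘ braid a b;
  pentagon : forall a b c d,
    assoc a b (tens c d) ∘ assoc (tens a b) c d =
    tensm (idm a) (assoc b c d) ∘ assoc a (tens b c) d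
      ∘ tensm (assoc a b c) (idm d);
  triangle : forall a b,
    tensm (idm a) (lunit b) ∘ assoc a tunit b = tensm (runit a) (idm b);
  hexagon : forall a b c,
    assoc b c a ∘ braid a (tens b c) ∘ assoc a b c =
    tensm (idm b) (braid a c) ∘ assoc b a c ∘ tensm (braid a b) (idm c);
  braidK : forall a b, braid b a ∘ braid a b = idm (tens a b) }.

Section PartialTensor.
Variables (C : preadditive) (M : symmetric_monoidal C) (a : C).

Lemma tens_leftM (b c d : C) (g : hom c d) (f : hom b c) :
  tensm M (idm a) (g ∘ f) = tensm M (idm a) g ∘ tensm M (idm a) f.
Proof. by rewrite -tensmM comp1m. Qed.

Definition tens_left : functor C C :=
  @Functor C C (fun b => tens M a b) (fun b c f => tensm M (idm a) f)
    (fun b => tensm1 M a b) tens_leftM.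

Lemma tens_rightM (b c d : C) (g : hom c d) (f : hom b c) :
  tensm M (g ∘ f) (idm a) = tensm M g (idm a) ∘ tensm M f (idm a).
Proof. by rewrite -tensmM comp1m. Qed.

Definition tens_right : functor C C :=
  @Functor C C (fun b => tens M b a) (fun b c f => tensm M f (idm a))
    (fun b => tensm1 M b a) tens_rightM.

End PartialTensor.

Record tt_category := TTCategory {
  tt_tri :> triangulated;
  tt_mon : symmetric_monoidal tt_tri;
  tens_left_exact : forall a : tt_tri, exact_functor (tens_left tt_mon a);
  tens_right_exact : forall a : tt_tri, exact_functor (tens_right tt_mon a) }.

Notation "a ⊗ b" := (tens (tt_mon _) a b) : tt_scope.

(* Full subcategories are given by their sets of objects. *)
Record thick_ideal (K : tt_category) (A : set K) : Prop := ThickIdeal {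
  thick_zero : A zob;
  thick_dist : forall (a b c : K) (f : hom a b) (g : hom b c) (h : hom c (T a)),
    dist f g h ->
    [/\ A a -> A b -> A c, A a -> A c -> A b & A b -> A c -> A a];
  thick_summand : forall a b c : K,
    A a -> isomorphic a (b ⊕ c) -> A b /\ A c;
  thick_tens : forall a b : K, A a -> A (a ⊗ b) }.

Record tt_prime (K : tt_category) (P : set K) : Prop := TTPrime {
  prime_thick : thick_ideal P;
  prime_proper : P `<` [set: K];
  prime_tens : forall a b : K, P (a ⊗ b) -> P a \/ P b }.

(* Essential smallness of [K] only serves to make the primes form a set; here
   the objects form a type, so the primes do as well and no hypothesis is needed. *)
Record Spc (K : tt_category) := SpcPrime {
  prime_set :> set K;
  prime_setP : tt_prime prime_set }.

Definition zariski (K : tt_category) (S : set K) : set (Spc K) :=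
  [set P : Spc K | S `&` P = set0].

Section Preadditive.
Variable C : preadditive.

Lemma comp0m (a b c : C) (f : hom a b) : (0 : hom b c) ∘ f = 0.
Proof. by apply: (@addrI _ (0 ∘ f)); rewrite -compDl !addr0. Qed.

Lemma compm0 (a b c : C) (g : hom b c) : g ∘ (0 : hom a b) = 0.
Proof. by apply: (@addrI _ (g ∘ 0)); rewrite -compDr !addr0. Qed.

Lemma compNm (a b c : C) (g : hom b c) (f : hom a b) : (- g) ∘ f = - (g ∘ f).
Proof. by apply: (@addrI _ (g ∘ f)); rewrite -compDl !subrr comp0m. Qed.

Lemma compmN (a b c : C) (g : hom b c) (f : hom a b) : g ∘ (- f) = - (g ∘ f).
Proof. by apply: (@addrI _ (g ∘ f)); rewrite -compDr !subrr compm0. Qed.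

Lemma is_iso_id (a : C) : is_iso (idm a).
Proof. by exists (idm a); rewrite comp1m. Qed.

Lemma is_isoN (a b : C) (f : hom a b) : is_iso f -> is_iso (- f).
Proof. by case=> g [gf fg]; exists (- g); rewrite !compNm !compmN !opprK. Qed.

Lemma isomorphic_sym (a b : C) : isomorphic a b -> isomorphic b a.
Proof. by case=> f [g [gf fg]]; exists g, f. Qed.

End Preadditive.

Section Triangles.
Variable K : triangulated.

Lemma additive_functor0 (F : functor K K) (a b : K) :
  additive_functor F -> fmap F (0 : hom a b) = 0.
Proof. by move=> FD; apply: (@addrI _ (fmap F 0)); rewrite -FD !addr0. Qed.

Lemma dist_comp0 (a b c : K) (f : hom a b) (g : hom b c) (h : hom c (T a)) :
  dist f g h -> g ∘ f = 0.
Proof.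
move=> d; have e : f ∘ idm a = f ∘ idm a by [].
by have [w [<- _]] := dist_morphism (dist_id a) d e; rewrite compm0.
Qed.

Lemma dist_zero_id (x : K) :
  dist (0 : hom zob x) (idm x) (0 : hom x (T zob)).
Proof.
apply/dist_rot; rewrite additive_functor0 ?oppr0; last exact: T_additive.
have TzE : idm (T (zob : K)) = 0.
  by rewrite -fmap1 (zob_initial (idm _)) additive_functor0 //;
    exact: T_additive.
apply: (@dist_iso K x x zob _ _ _ _ _ _ _ _ _ (idm x) (idm x) 0 _ _ _ _ _ _
  (dist_id x)); rewrite ?compm0 ?comp0m //; try exact: is_iso_id.
exists 0; rewrite compm0 comp0m TzE; split=> //.
by rewrite (zob_initial (idm _)).
Qed.

Lemma dist_weak_cokernel (a b c x : K)
    (f : hom a b) (g : hom b c) (h : hom c (T a)) (k : hom b x) :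
  dist f g h -> k ∘ f = 0 -> exists k' : hom c x, k = k' ∘ g.
Proof.
move=> d kf; have e : k ∘ f = 0 ∘ (0 : hom a zob) by rewrite kf compm0.
have [w [wg _]] := dist_morphism d (dist_zero_id x) e.
by exists w; rewrite wg comp1m.
Qed.

Lemma cone_inj1 (a b c : K) (g : hom (a ⊕ b) c) (h : hom c (T a)) :
  dist (inj1 a b) g h -> isomorphic b c.
Proof.
move=> d.
have d1 := (dist_rot _ _ _).1 d.
have d2 := (dist_rot _ _ _).1 d1.
have h0 : h = 0.
  have /eqP := dist_comp0 d2; rewrite compNm oppr_eq0 => /eqP ih0.
  by rewrite -[h]comp1m -fmap1 -(prj1_inj1 a b) fmapM -compA ih0 compm0.
have [q pE] := dist_weak_cokernel d (prj2_inj1 a b).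
have gi : g ∘ inj1 a b = 0 by apply: dist_comp0 d.
exists (g ∘ inj2 a b), q; split; first by rewrite compA -pE prj2_inj2.
have e : (g ∘ inj2 a b ∘ q - idm c) ∘ g = 0.
  rewrite compDl compNm comp1m -compA -pE -compA.
  have -> : g ∘ (inj2 a b ∘ prj2 a b) = g.
    rewrite -[RHS](compm1 g) -(osum_id a b) compDr.
    by rewrite [X in X + _]compA gi comp0m add0r.
  by rewrite subrr.
have [y yE] := dist_weak_cokernel d1 e.
by apply/eqP; rewrite -subr_eq0 yE h0 compm0.
Qed.

End Triangles.

Section ThickIdeals.
Variables (K : tt_category) (A : set K).
Hypothesis tA : thick_ideal A.

Lemma thick_iso (a b : K) : A a -> isomorphic a b -> A b.
Proof.
move=> Aa [f [g [gf fg]]].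
suff : isomorphic a (b ⊕ zob) by case/(thick_summand tA Aa).
exists (inj1 b zob ∘ f), (g ∘ prj1 b zob); split.
  by rewrite -compA [prj1 _ _ ∘ _]compA prj1_inj1 comp1m.
rewrite -compA [f ∘ _]compA fg comp1m -(osum_id b zob).
by rewrite [prj2 _ _](zob_terminal) compm0 addr0.
Qed.

Lemma thick_osum (a b : K) : A (a ⊕ b) <-> A a /\ A b.
Proof.
split=> [Aab|[Aa Ab]].
  apply: (thick_summand tA Aab).
  by exists (idm _); apply: is_iso_id.
have [c [g [h d]]] := dist_cone (inj1 a b).
have [_ + _] := thick_dist tA d; apply=> //.
by apply: thick_iso Ab _; apply: cone_inj1 d.
Qed.

End ThickIdeals.

Section SpcTopology.
Variable K : tt_category.

HB.instance Definition _ := gen_eqMixin (Spc K).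
HB.instance Definition _ := gen_choiceMixin (Spc K).

Lemma zariskiP (S : set K) (P : Spc K) :
  zariski S P <-> forall a, S a -> ~ prime_set P a.
Proof.
rewrite /zariski /=; split=> [SP0 a Sa Pa|SP].
  by have : (S `&` P) a by []; rewrite SP0.
by apply/seteqP; split=> a //= [/SP].
Qed.

Definition zariski_open : set_system (Spc K) :=
  [set U | exists S : set K, U = ~` zariski S].

Lemma zariski_openT : zariski_open setT.
Proof.
exists setT; apply/seteqP; split=> // P _ /zariskiP /(_ zob I); apply.
exact: thick_zero (prime_thick (prime_setP P)).
Qed.

Lemma zariski_openI : setI_closed zariski_open.
Proof.
move=> _ _ [S1 ->] [S2 ->].
exists [set a1 ⊕ a2 | a1 in S1 & a2 in S2].
rewrite -setCU; congr (~` _); apply/seteqP; split=> P.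
  have tP := prime_thick (prime_setP P).
  move=> H; apply/zariskiP => _ [a1 S1a1] [a2 S2a2] <-.
  move/(thick_osum tP) => [Pa1 Pa2].
  by case: H => /zariskiP H; [exact: H S1a1 Pa1|exact: H S2a2 Pa2].
have tP := prime_thick (prime_setP P).
move/zariskiP=> H; have [?|nS1] := pselect (zariski S1 P); [by left|right].
apply/zariskiP => a2 S2a2 Pa2; apply: nS1; apply/zariskiP => a1 S1a1 Pa1.
apply: (H (a1 ⊕ a2)); first by exists a1 => //; exists a2.
by apply/thick_osum.
Qed.

Lemma zariski_open_bigcup (J : Type) (U : J -> set (Spc K)) :
  (forall i, zariski_open (U i)) -> zariski_open (\bigcup_i U i).
Proof.
move=> /choice[S US]; exists (\bigcup_i S i).
rewrite -[LHS]setCK; congr (~` _); rewrite setC_bigcup.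
apply/seteqP; split=> P.
  move=> H; apply/zariskiP => a [i _ Sia].
  by move: (H i I); rewrite US setCK => /zariskiP; apply.
move=> /zariskiP H i _; rewrite US setCK; apply/zariskiP => a Sia.
by apply: H; exists i.
Qed.

HB.instance Definition _ := isOpenTopological.Build (Spc K)
  zariski_openT zariski_openI zariski_open_bigcup.

Lemma closed_zariskiP (Z : set (Spc K)) :
  closed Z <-> exists S : set K, Z = zariski S.
Proof.
rewrite -openC; split=> [[S ZE]|[S ->]]; last by exists S.
by exists S; rewrite -[LHS]setCK ZE setCK.
Qed.

End SpcTopology.

Definition closed_point (X : topologicalType) (x : X) : Prop := closed [set x].

(* Main.v *)
Require Import Defs.
From mathcomp Require Import all_boot.
From mathcomp Require Import boolp classical_sets topology.
Local Open Scope classical_set_scope.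

(** The closure of a point [P] of the spectrum consists of the primes contained
    in [P], the reverse of the specialization order of commutative algebra:
    the closed set defined by the complement of [P] is [{Q | Q `<=` P}], and
    every closed set containing [P] contains all of these, since a smaller
    prime avoids more objects. Hence minimal primes are closed points
    ([closed_point_minimal]), and it is enough to find a minimal prime below
    a given point of a closed set ([exists_minimal_prime]). That is Zorn's
    lemma: the intersection of a nonempty chain of primes is a prime
    ([tt_prime_bigcap]). *)

Section Intersections.
Variables (K : tt_category) (I : Type) (D : set I) (F : I -> set K).

Lemma thick_ideal_bigcap :
  (forall i, D i -> thick_ideal (F i)) ->
  thick_ideal (\bigcap_(i in D) F i).
Proof.
move=> tF; split.
- by move=> i Di; apply: thick_zero (tF i Di).
- move=> a b c f g h d; split=> Fx Fy i Di;
    have [ab_c ac_b bc_a] := thick_dist (tF i Di) d.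
  + by apply: ab_c; [apply: Fx|apply: Fy].
  + by apply: ac_b; [apply: Fx|apply: Fy].
  + by apply: bc_a; [apply: Fx|apply: Fy].
- move=> a b c Fa iso_a; split=> i Di;
    by have [] := thick_summand (tF i Di) (Fa i Di) iso_a.
- by move=> a b Fa i Di; exact: thick_tens (tF i Di) _ _ (Fa i Di).
Qed.

(** As for prime ideals of a ring: if [a] is missed by one member of the chain
    and [b] by another, the smaller of the two members misses both, hence also
    their product. Nonemptiness of the chain makes the intersection proper. *)
Lemma tt_prime_bigcap :
  D !=set0 -> total_on D (fun i j => F i `<=` F j) ->
  (forall i, D i -> tt_prime (F i)) ->
  tt_prime (\bigcap_(i in D) F i).
Proof.
move=> [i0 Di0] totF pF; split.
- by apply: thick_ideal_bigcap => i Di; apply: prime_thick (pF i Di).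
- split=> // sub; apply: (prime_proper (pF i0 Di0)).2.
  by move=> a /sub; apply.
- move=> a b Fab; apply: contrapT => /not_orP[].
  move=> /existsNP[i /not_implyP[Di Fia]] /existsNP[j /not_implyP[Dj Fjb]].
  have [Fij|Fji] := totF i j Di Dj.
  + by have [/Fia|/Fij/Fjb] := prime_tens (pF i Di) (Fab i Di).
  + by have [/Fji/Fia|/Fjb] := prime_tens (pF j Dj) (Fab j Dj).
Qed.

End Intersections.

Section MinimalPrimes.
Variable K : tt_category.
Implicit Types P Q : Spc K.

Lemma Spc_ext P Q : prime_set P = prime_set Q -> P = Q.
Proof.
case: P Q => [P pP] [Q pQ] /= PQ; case: _ / PQ in pQ *.
by congr SpcPrime; apply: Prop_irrelevance.
Qed.

Definition minimal_prime P : Prop :=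
  forall Q, prime_set Q `<=` P -> prime_set Q = P.

(** Zorn's lemma is used on the primes below [P] rather than on all primes, so
    that the minimal one found stays below [P]; the empty chain is then bounded
    by [P] itself. *)
Lemma exists_minimal_prime P :
  exists2 M : Spc K, prime_set M `<=` P & minimal_prime M.
Proof.
pose below := {Q : Spc K | prime_set Q `<=` P}.
pose objs (Q : below) : set K := prime_set (sval Q).
pose R (Q1 Q2 : below) := `[< objs Q2 `<=` objs Q1 >].
have [| | |[M MP] Mmax] :=
    @ZL_preorder below (exist _ P (@subset_refl _ P)) R.
- by move=> Q; apply/asboolP.
- by move=> Q1 Q2 Q3 /asboolP Q21 /asboolP Q32; apply/asboolP => a /Q32/Q21.
- move=> A totA; have [[Q0 AQ0]|A0] := pselect (A !=set0); last first.
    exists (exist _ P (@subset_refl _ P)) => Q AQ.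
    by case: A0; exists Q.
  have pA : tt_prime (\bigcap_(Q in A) objs Q).
    apply: tt_prime_bigcap; first by exists Q0.
      by move=> Q1 Q2 AQ1 AQ2; case: (totA Q1 Q2 AQ1 AQ2) => /asboolP; auto.
    by move=> Q _; apply: prime_setP.
  have AP : prime_set (SpcPrime pA) `<=` P.
    by move=> a /(_ Q0 AQ0); apply: (svalP Q0).
  exists (exist (fun Q : Spc K => Q `<=` P) (SpcPrime pA) AP) => Q AQ.
  by apply/asboolP => a /(_ Q AQ).
exists M => // Q QM; apply/seteqP; split=> //.
exact: asboolW (Mmax (exist _ Q (subset_trans QM MP)) (asboolT QM)).
Qed.

(** The closed set of primes avoiding the complement of [P] consists of the
    primes contained in [P]; by minimality it is [{P}]. *)
Lemma closed_point_minimal P : minimal_prime P -> closed_point P.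
Proof.
move=> Pmin; apply/closed_zariskiP; exists (~` prime_set P).
apply/seteqP; split=> Q /=; first by move=> ->; apply: setICl.
rewrite /zariski /= setIC => /subsets_disjoint QP.
exact/Spc_ext/Pmin.
Qed.

Lemma zariski_subset (S : set K) P Q :
  prime_set Q `<=` P -> zariski S P -> zariski S Q.
Proof.
by move=> QP /zariskiP SP; apply/zariskiP => a Sa /QP; apply: SP.
Qed.

End MinimalPrimes.

Theorem corollary2p12 (K : tt_category) :
  ([set: Spc K] !=set0 -> exists P : Spc K, closed_point P) /\
  (forall Z : set (Spc K), closed Z -> Z !=set0 ->
     exists P : Spc K, Z P /\ closed_point P).
Proof.
split=> [[P _]|_ /closed_zariskiP[S ->] [P SP]];
    have [M MP /closed_point_minimal Mcl] := exists_minimal_prime K P.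
  by exists M.
by exists M; split=> //; apply: zariski_subset MP SP.
Qed.
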